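(* Let $X$ be a compact Hausdorff topological space and let $f_1,\dots,f_k:X\to X$ be continuous maps generating a forward minimal IFS. If this IFS is renderable by the deterministic chaos game, then it is also backward minimal.
   Context: $\Gamma$ is the semigroup generated by $f_1,\dots,f_k$ (all compositions of one or more generators). The IFS is forward minimal if the only non-empty closed set $B\subset X$ with $g(B)\subset B$ for all $g\in\Gamma$ is $B=X$. A set $B\subset X$ is backward invariant if $\emptyset\neq g^{-1}(B)\subset B$ for all $g\in\Gamma$ (where $g^{-1}(B)$ is the preimage); the IFS is backward minimal if the only non-empty closed backward invariant set is $X$. $\Omega=\{1,\dots,k\}^{\mathbb{N}}$; for $\omega\in\Omega$, $f^n_\omega=f_{\omega_n}\circ\cdots\circ f_{\omega_1}$ and $O^+_\omega(x)=\{f^n_\omega(x):n\in\mathbb{N}\}$. $\mathbb{P}$ is any fixed Borel probability on $\Omega$ for which there is $0<p\le1/k$ with $\mathbb{P}(\omega_n=i\mid\omega_{n-1},\dots,\omega_1)\ge p$ for all $i\in\{1,\dots,k\}$, $n\in\mathbb{N}$. A forward minimal IFS on the compact space $X$ is renderable by the deterministic chaos game if there is $\Omega_0\subset\Omega$ with $\mathbb{P}(\Omega_0)=1$ such that $\overline{O^+_\omega(x)}=X$ for all $\omega\in\Omega_0$ and $x\in X$. *)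

(* Defs.v *)
From HB Require Import structures.
From mathcomp Require Import all_boot all_order all_algebra.
From mathcomp Require Import all_classical all_reals all_analysis.

Set Implicit Arguments.
Unset Strict Implicit.
Unset Printing Implicit Defensive.
Import Order.TTheory GRing.Theory Num.Theory.
Local Open Scope classical_set_scope.
Local Open Scope ring_scope.

(* An iterated function system is given by its generators, a nonempty finite
   family f : 'I_k.+1 -> X -> X; there are k.+1 of them, numbered from 0. *)

Section IFS.
Variables (X : topologicalType) (k : nat) (f : 'I_k.+1 -> X -> X).

Inductive ifs_semigroup : set (X -> X) :=
| ifs_gen i : ifs_semigroup (f i)
| ifs_comp g h : ifs_semigroup g -> ifs_semigroup h -> ifs_semigroup (g \o h).

Definition forward_invariant (B : set X) :=
  forall g, ifs_semigroup g -> g @` B `<=` B.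

Definition forward_minimal :=
  forall B : set X, B !=set0 -> closed B -> forward_invariant B -> B = setT.

Definition backward_invariant (B : set X) :=
  forall g, ifs_semigroup g -> g @^-1` B !=set0 /\ g @^-1` B `<=` B.

Definition backward_minimal :=
  forall B : set X, B !=set0 -> closed B -> backward_invariant B -> B = setT.

End IFS.

(* Words are indexed from 0: w n stands for the (n+1)-st letter. *)
Definition word_space (k : nat) : Type :=
  prod_topology (fun _ : nat => discrete_topology 'I_k.+1).

HB.instance Definition _ k := Topological.on (word_space k).
HB.instance Definition _ k :=
  isPointed.Build (word_space k) (fun _ : nat => ord0 : 'I_k.+1).

(* The same space of words, carrying the Borel sigma-algebra. *)
Definition Omega (k : nat) := g_sigma_algebraType (@open (word_space k)).

(* iterate f w n = f_{w (n-1)} \o ... \o f_{w 0} *)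
Fixpoint iterate (X : Type) (k : nat) (f : 'I_k.+1 -> X -> X)
    (w : Omega k) (n : nat) (x : X) : X :=
  if n is m.+1 then f (w m) (iterate f w m x) else x.

(* The times are n = 1, 2, ..., as for the letters of a word: the starting
   point of the orbit is not included. *)
Definition orbit_along (X : Type) (k : nat) (f : 'I_k.+1 -> X -> X)
    (w : Omega k) (x : X) : set X :=
  [set iterate f w n x | n in [set n | (0 < n)%N]].

Definition cylinder (k : nat) (u : Omega k) (n : nat) : set (Omega k) :=
  [set w | forall j, (j < n)%N -> w j = u j].

Section ChaosGame.
Variables (R : realType) (k : nat) (P : probability (Omega k) R).

Definition cond_prob (A B : set (Omega k)) : R :=
  fine (P (A `&` B)) / fine (P B).

(* The conditional probability of a letter given all the preceding ones is
   taken on each cylinder, where it is defined, i.e. where the cylinder has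
   positive probability. *)
Definition lower_bounded_letters :=
  exists p : R, [/\ 0 < p, p <= (k.+1%:R)^-1 &
    forall (n : nat) (u : Omega k) (i : 'I_k.+1),
      (0 < P (cylinder u n))%E ->
      p <= cond_prob [set w | w n = i] (cylinder u n)].

Definition renderable (X : topologicalType) (f : 'I_k.+1 -> X -> X) :=
  exists Omega0 : set (Omega k), [/\ measurable Omega0, P Omega0 = 1%E &
    forall w x, Omega0 w -> closure (orbit_along f w x) = setT].

End ChaosGame.

(* Main.v *)
(* Let B be a nonempty closed backward invariant set and w a word whose orbits are all dense.
   The preimages of B under the maps iterate f w n.+1 are nonempty and closed,
   and they decrease with n because f i @^-1` B `<=` B.  By compactness some x
   lies in all of them; the orbit of x along w then stays in the closed set B,
   although it is dense, so B is the whole space. *)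
Require Import Defs.
From HB Require Import structures.
From mathcomp Require Import all_boot all_order all_algebra.
From mathcomp Require Import all_classical all_reals all_analysis.

Set Implicit Arguments.
Unset Strict Implicit.
Unset Printing Implicit Defensive.
Local Open Scope classical_set_scope.
Local Open Scope ring_scope.

(** Being nested and nonempty, the sets [F n] form a base of a proper filter; by compactness it has
    a cluster point, which lies in each [F n] because these are closed. *)
Lemma compact_nonincreasing_bigcap (T : topologicalType) (F : nat -> set T) :
  compact [set: T] -> (forall n, closed (F n)) -> (forall n, F n !=set0) ->
  (forall n, F n.+1 `<=` F n) -> \bigcap_n F n !=set0.
Proof.
move=> cT Fcl F0 Fdec.
have Fmono m n : (m <= n)%N -> F n `<=` F m.
  move=> /subnK <-; elim: (n - m)%N => [|d IHd] //.
  by rewrite addSn; exact: subset_trans (Fdec _) IHd.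
have PF : ProperFilter (filter_from setT F).
  apply: filter_from_proper => //; apply: filter_from_filter; first by exists 0%N.
  move=> m n _ _; exists (maxn m n) => // x Fx.
  by split; apply: Fmono Fx; rewrite (leq_maxl, leq_maxr).
have [] := cT _ PF; first by exists 0%N.
move=> x [_ clx]; exists x => n _; apply: Fcl => U Ux.
by apply: clx Ux; exists n.
Qed.

Lemma ifs_semigroup_iterate (X : topologicalType) (k : nat)
    (f : 'I_k.+1 -> X -> X) (w : Omega k) (n : nat) :
  ifs_semigroup f (iterate f w n.+1).
Proof.
elim: n => [|n IHn]; first exact: (ifs_gen f (w 0%N)).
exact: ifs_comp (ifs_gen f (w n.+1)) IHn.
Qed.

Lemma continuous_iterate (X : topologicalType) (k : nat)
    (f : 'I_k.+1 -> X -> X) (w : Omega k) (n : nat) :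
  (forall i, continuous (f i)) -> continuous (iterate f w n).
Proof.
move=> cf; elim: n => [|n IHn] x /=; first exact: cvg_id.
by apply: continuous_comp; [exact: IHn | exact: cf].
Qed.

Lemma backward_invariant_orbit_sub (X : topologicalType) (k : nat)
    (f : 'I_k.+1 -> X -> X) (B : set X) (w : Omega k) :
  compact [set: X] -> (forall i, continuous (f i)) -> closed B ->
  backward_invariant f B -> exists x, orbit_along f w x `<=` B.
Proof.
move=> cX cf clB invB.
(* Time 0 is left out: [ifs_semigroup] need not contain the identity, and orbits start at time 1. *)
have [x Bx] : \bigcap_n (iterate f w n.+1 @^-1` B) !=set0.
  apply: compact_nonincreasing_bigcap => // n.
  - by apply: preimage_closed => // y _; exact: continuous_iterate.
  - by have [] := invB _ (ifs_semigroup_iterate f w n).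
  (* The letter [w n.+1] acts last, so invariance under its generator is applied at the point
     [iterate f w n.+1 y]. *)
  - by move=> y; have [_] := invB _ (ifs_gen f (w n.+1)); apply.
by exists x => _ [[//|n] _ <-]; exact: Bx.
Qed.

Theorem theorem5 (R : realType) (X : topologicalType) (k : nat)
    (f : 'I_k.+1 -> X -> X) (P : probability (Omega k) R)
    (compactX : compact [set: X]) (hausdorffX : hausdorff_space X)
    (f_continuous : forall i, continuous (f i))
    (f_forward_minimal : forward_minimal f)
    (P_letters : lower_bounded_letters P)
    (f_renderable : renderable P f) :
  backward_minimal f.
Proof.
move=> B _ clB invB.
have [W [_ PW dens]] := f_renderable.
have [w Ww] : W !=set0.
  (* An empty [W] would have probability 0 instead of 1. *)
  apply/set0P/negP => /eqP W0; move/eqP: PW.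
  by rewrite W0 measure0 eq_sym onee_eq0.
have [x /closure_subset] :=
  backward_invariant_orbit_sub w compactX f_continuous clB invB.
by rewrite dens // -(closure_id B).1 // subTset.
Qed.
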